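(* For all positive integers $n$, $k$, and $l$ with $k>l$, \[ \mu(\mathbb{Z}_n,\{k,l\}) \;=\; \max_{d\mid n}\left\{ \left\lceil \frac{d-(\delta-r)}{k+l}\right\rceil \cdot \frac{n}{d}\right\}, \] where, for each divisor $d$ of $n$, $\delta=\gcd(d,k-l)$ and $r$ is the remainder of $l\left\lceil (d-\delta)/(k+l)\right\rceil$ modulo $\delta$.
   Context: For a subset $A$ of an abelian group $G$ and a positive integer $h$, $hA$ denotes the $h$-fold sumset $\{a_1+\cdots+a_h : a_1,\dots,a_h\in A\}$ (elements not necessarily distinct). For positive integers $k>l$, a subset $A\subseteq G$ is called $(k,l)$-sum-free if $kA\cap lA=\emptyset$, equivalently $0\notin kA-lA$. $\mu(G,\{k,l\})$ denotes the maximum size of a $(k,l)$-sum-free subset of $G$ (the empty set counts, so the maximum is at least $0$). $\mathbb{Z}_n=\mathbb{Z}/n\mathbb{Z}$. *)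

(* Defs.v *)
From HB Require Import structures.
From mathcomp Require Import all_boot all_order all_algebra.
Set Implicit Arguments.
Unset Strict Implicit.
Unset Printing Implicit Defensive.

Import Order.TTheory GRing.Theory Num.Theory.

(* h-fold sumset hA; repetitions among the summands are allowed. *)
Definition sumset (G : finZmodType) (h : nat) (A : {set G}) : {set G} :=
  [set (\sum_(i < h) a i)%R | a : {ffun 'I_h -> G} in ffun_on (mem A)].

Definition sum_free (G : finZmodType) (k l : nat) (A : {set G}) : bool :=
  [disjoint sumset k A & sumset l A].

Definition mu (G : finZmodType) (k l : nat) : nat :=
  \max_(A : {set G} | sum_free k l A) #|A|.

(* Z/nZ for n > 0, as the additive group of integers mod n. The ring 'Z_n is
   not used because 'Z_1 has two elements. *)
Notation Zmod n := 'I_n.-1.+1 (only parsing).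

Definition ceil_div (a b : nat) : nat := (a + b.-1) %/ b.

Lemma ceil_divE (a b : nat) (b_gt0 : 0 < b) :
  ((ceil_div a b)%:Z = Num.ceil (a%:Q / b%:Q))%R.
Proof.
have b0 : (0 < b%:Q)%R by rewrite ltr0n.
apply/esym/ceil_def/andP; split.
  rewrite ltr_pdivlMr // -intrM ltr_int mulrBl mul1r ltrBlDr.
  rewrite -PoszM -PoszD ltz_nat /ceil_div.
  have := leq_divM (a + b.-1) b.
  by case: b b_gt0 {b0} => // b _ /=; rewrite addnS ltnS.
rewrite ler_pdivrMr // -intrM ler_int -PoszM lez_nat /ceil_div.
have := ltn_ceil (a + b.-1) b_gt0.
by case: b b_gt0 {b0} => // b _ /=; rewrite mulSnr addnS ltnS leq_add2r.
Qed.

Definition delta (k l d : nat) : nat := gcdn d (k - l).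

Definition rem_r (k l d : nat) : nat :=
  (l * ceil_div (d - delta k l d) (k + l)) %% delta k l d.

(* No truncation occurs in the subtractions below or in [rem_r] when d > 0 and
   l < k: then rem_r k l d < delta k l d <= d. *)
Definition divisor_bound (n k l d : nat) : nat :=
  ceil_div (d - (delta k l d - rem_r k l d)) (k + l) * (n %/ d).

(* Main.v *)
Require Import Defs.
From mathcomp Require Import all_boot all_order all_algebra all_fingroup all_solvable zify.
Set Implicit Arguments.
Unset Strict Implicit.
Unset Printing Implicit Defensive.

(** Upper bound.  Written multiplicatively, [A] is (k,l)-sum-free when [1] is not
    in [A^k A^-l].  Passing to the quotient by a subgroup [H] such that [A H] is
    still sum-free, one may assume that there is no nontrivial such [H].  After a
    translation [A] contains [1]; let [U] be the group it generates.  If every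
    [X] in [U] with [|X| > 1] and [|X A| < |U| - 1] satisfies
    [|X A| >= |X| + |A|], then the partial products of [A^k A^-l] grow by [|A|]
    at each step, so [(k + l) |A| <= |U|].  Otherwise, by Hamidoune's theory of
    atoms, one of the exceptional [X] is a subgroup or a pair.  A subgroup [H]
    would leave fewer than [|H|] holes in [A H], making [A A A^-1], hence
    [A^k A^-l], [H]-periodic; a pair [{1, x}] forces [A] to be a progression of
    ratio [x], for which the bound is a computation.

    Lower bound.  Progressions modulo [d], pulled back to Z/n. *)

(** * Intervals modulo d *)

Lemma ltn_ceil_div a b m : 0 < b -> (m < ceil_div a b) = (m * b < a).
Proof.
by case: b => // b _; rewrite /ceil_div /= leq_divRL // mulSn; lia.
Qed.

Lemma delta_gt0 k l d : l < k -> 0 < delta k l d.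
Proof. by move=> lk; rewrite gcdn_gt0 subn_gt0 lk orbT. Qed.

Lemma delta_le k l d : l < k -> delta k l d <= k - l.
Proof. by move=> lk; rewrite dvdn_leq ?subn_gt0 ?dvdn_gcdr. Qed.

Lemma exists_dvdn_gt c m : 0 < c -> exists2 w, c %| w & m < w <= m + c.
Proof.
move=> c0; exists ((m %/ c).+1 * c); first exact: dvdn_mull.
by have := ltn_pmod m c0; rewrite {2 3}(divn_eq m c) mulSn; lia.
Qed.

(* [w] represents [(k - l) c] for an interval of length [m.+1] starting at [c]:
   the interval is (k,l)-sum-free in Z/d iff [w] avoids [-k m .. l m] mod d. *)
Lemma interval_boundP d k l m : 0 < d -> 0 < l -> l < k ->
  reflect (exists w, [/\ delta k l d %| w, l * m < w & w + k * m < d])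
    (m < ceil_div (d - (delta k l d - rem_r k l d)) (k + l)).
Proof.
move=> d0 l0 lk; have kl0 : 0 < k + l by lia.
have c0 := delta_gt0 d lk; have ck := delta_le d lk.
have cd : delta k l d <= d by rewrite dvdn_leq ?dvdn_gcdl.
rewrite ltn_ceil_div // /rem_r; move: (delta k l d) c0 ck cd => c c0 ck cd.
set f := ceil_div (d - c) (k + l).
have ltf : f * (k + l) >= d - c.
  by rewrite leqNgt -ltn_ceil_div // ltnn.
have r_lt := ltn_pmod (l * f) c0; have r_le := leq_mod (l * f) c.
apply: (iffP idP) => [lt_m|[w [cw lw kw]]].
- have m_f : m <= f by rewrite -ltnS -(ltn_pmul2r kl0) mulSn; lia.
  (* For [m < f], the bound [m * (k + l) < d - c] leaves room for a full step of [c]. Only [m = f]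
     needs the exact least multiple of [c] above [l * f], where the remainder enters. *)
  have [e|lt_mf] := eqVneq m f; last first.
    have : m * (k + l) < d - c by rewrite -ltn_ceil_div // ltn_neqAle lt_mf.
    by have [w cw] := exists_dvdn_gt (l * m) c0; exists w; split=> //; nia.
  rewrite e; exists (l * f - (l * f) %% c + c); split.
  + by rewrite dvdn_addl // {1}(divn_eq (l * f) c) addnK dvdn_mull.
  + by move: r_lt r_le; move: (_ %% _) => r; lia.
  + move: r_lt r_le lt_m e; move: (_ %% _) => r; nia.
- have [lt_mf|le_fm] := ltnP m f.
    have : m * (k + l) < d - c by rewrite -ltn_ceil_div.
    by lia.
  have w_r g : l * g < w -> l * g - (l * g) %% c + c <= w.
    have -> : l * g - (l * g) %% c = (l * g) %/ c * c by rewrite {1}(divn_eq (l * g) c) addnK.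
    rewrite -(divnK cw) -mulSnr leq_pmul2r // => lt_w.
    rewrite -(ltn_pmul2r c0); apply: leq_ltn_trans lt_w.
    exact: leq_divM.
  have : m = f.
    have := w_r m lw; have := ltn_pmod (l * m) c0; have := leq_mod (l * m) c; nia.
  by move=> e; subst m; have := w_r f lw; nia.
Qed.

(** * Lower bound: pulling back an interval of Z/d *)

Lemma sumset_modn p h d (A : {set 'I_p.+1}) C m x :
  d %| p.+1 -> (forall a, a \in A -> exists2 i, i <= m & a = C + i %[mod d]) ->
  x \in sumset h A -> exists2 s, s <= h * m & x = h * C + s %[mod d].
Proof.
move=> dp hA /imsetP[a /ffun_onP aA ->].
elim: h a aA => [|h IHh] a aA; first by exists 0; rewrite ?big_ord0.
have [|s sm es] := IHh [ffun i => a (lift ord0 i)] _.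
  by move=> i; rewrite ffunE; apply: aA.
have [i im ei] := hA _ (aA ord0).
exists (i + s); first by rewrite mulSn leq_add.
rewrite mulSn addnACA -(modnDml (C + i)) -ei modnDml -modnDmr -es modnDmr.
rewrite big_ord_recl /= modn_dvdm //; congr ((_ + val _) %% d).
by apply: eq_bigr => j _; rewrite ffunE.
Qed.

(** Bézout gives [C] with [(k - l) * C = w] modulo [d]. The set is the full preimage of
    [C, ..., C + m]; a sum of both kinds would give [w + s = t] modulo [d], impossible since
    [t <= l * m < w] and [w + s < d]. *)
Lemma exists_sum_free p d k l m : d %| p.+1 -> l < k ->
  (exists w, [/\ delta k l d %| w, l * m < w & w + k * m < d]) ->
  exists2 A : {set 'I_p.+1}, sum_free k l A & #|A| = m.+1 * (p.+1 %/ d).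
Proof.
move=> dp lk [w [dw lw wk]]; set e := p.+1 %/ d.
have ed : e * d = p.+1 by rewrite divnK.
have [C eC] : exists C, (k - l) * C = w %[mod d].
  have kl0 : 0 < k - l by rewrite subn_gt0.
  case: (egcdnP d kl0) => u v euv _; rewrite gcdnC in euv.
  exists (u * (w %/ delta k l d)); rewrite mulnA (mulnC (k - l)) euv mulnDl.
  by rewrite mulnAC modnMDl (mulnC (gcdn _ _)) divnK.
pose f (ij : 'I_m.+1 * 'I_e) : 'I_p.+1 := inord ((C + (ij.1 + ij.2 * d)) %% p.+1).
have fE ij : f ij = (C + (ij.1 + ij.2 * d)) %% p.+1 :> nat.
  by rewrite /f inordK // ltn_pmod.
have d0 : 0 < d by apply: dvdn_gt0 dp.
have md (i : 'I_m.+1) : i < d.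
  apply: leq_trans (ltn_ord i) _; apply: leq_ltn_trans wk.
  by rewrite (leq_trans _ (leq_addl _ _)) // leq_pmull // (leq_ltn_trans _ lk).
have f_inj : injective f.
  move=> [i j] [i' j'] /(congr1 val)/eqP; rewrite /= !fE eqn_modDl /= -ed.
  have lt (i1 : 'I_m.+1) (j1 : 'I_e) : i1 + j1 * d < e * d.
    apply: leq_trans (_ : j1.+1 * d <= _); first by rewrite mulSn ltn_add2r md.
    by rewrite leq_mul2r ltn_ord orbT.
  rewrite !(modn_small (lt _ _)) => /eqP eij.
  have ei : i = i'.
    have := congr1 (modn^~ d) eij; rewrite /= !(addnC (val _)) !modnMDl !(modn_small (md _)).
    exact: val_inj.
  move: eij; rewrite ei => /addnI/eqP; rewrite eqn_pmul2r //.
  by move/eqP/val_inj ->.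
exists (f @: setT); last by rewrite card_imset // cardsT card_prod !card_ord.
rewrite /sum_free -setI_eq0; apply/eqP/setP=> x; rewrite !inE; apply/negP=> /andP[].
have hA a : a \in f @: setT -> exists2 i, i <= m & a = C + i %[mod d].
  case/imsetP=> -[i j] _ ->; exists i; first by rewrite -ltnS.
  by rewrite fE modn_dvdm //= addnA addnC modnMDl.
move=> /(sumset_modn dp hA)[s sk es] /(sumset_modn dp hA)[t tl et].
have : w + s = t %[mod d].
  apply/eqP; rewrite -modnDml -eC modnDml -(eqn_modDl (l * C)) addnA -mulnDl.
  by rewrite subnKC 1?ltnW // -es et.
rewrite !modn_small; clear -lw wk sk tl; lia.
Qed.

Local Open Scope group_scope.

(** * Atoms *)

(* Equal cardinals may occur in convertible but syntactically different forms
   (several canonical finType structures on a group); [lia] needs one form. *)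
Ltac card_lia :=
  repeat match goal with
  | H : context [card _] |- _ => revert H end;
  repeat (let n := fresh "n" in set n := #|_|; move: n => n);
  lia.

Lemma card_mulg_ge (gT : finGroupType) (X S : {set gT}) s :
  s \in S -> #|X| <= #|X * S|.
Proof. by move=> sS; rewrite -(card_rcoset X s) subset_leq_card // mulgS ?sub1set. Qed.

Lemma mulg_abelianC (gT : finGroupType) (U : {group gT}) (A B : {set gT}) :
  abelian U -> A \subset U -> B \subset U -> A * B = B * A.
Proof.
move=> abU AU BU; apply: centC.
exact: subset_trans AU (subset_trans abU (centS BU)).
Qed.

(** As in Hamidoune's 2-separability, at least two points of [U] stay outside [X * S]. *)
Definition separating (gT : finGroupType) (U : {group gT}) (S X : {set gT}) :=
  [&& X \subset U, 1 < #|X| & #|X * S| + 1 < #|U|].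

(** A 2-atom: a minimiser of [#|X * S| - #|X|] over separating sets, of least cardinal among the
    minimisers. Sums replace differences to avoid truncation. *)
Definition atom (gT : finGroupType) (U : {group gT}) (S M : {set gT}) :=
  [/\ separating U S M,
      forall X : {set gT}, separating U S X -> #|M * S| + #|X| <= #|X * S| + #|M|
    & forall X : {set gT}, separating U S X ->
        #|X * S| + #|M| <= #|M * S| + #|X| -> #|M| <= #|X|].

Lemma separating_lcoset (gT : finGroupType) (U : {group gT}) (S X : {set gT}) g :
  g \in U -> separating U S X -> separating U S (g *: X).
Proof.
move=> gU /and3P[XU X1 XS]; apply/and3P; split; last 2 first.
- by rewrite card_lcoset.
- by rewrite -mulgA card_lcoset.
- by rewrite mul_subG ?sub1set.
Qed.

Lemma atom_lcoset (gT : finGroupType) (U : {group gT}) (S M : {set gT}) g :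
  g \in U -> atom U S M -> atom U S (g *: M).
Proof.
move=> gU [sM minM sizeM]; split; first exact: separating_lcoset.
- by move=> X; rewrite -mulgA !card_lcoset; apply: minM.
- by move=> X; rewrite -mulgA !card_lcoset; apply: sizeM.
Qed.

Lemma exists_atom (gT : finGroupType) (U : {group gT}) (S X : {set gT}) :
  S != set0 -> separating U S X -> exists2 M : {set gT}, 1 \in M & atom U S M.
Proof.
case/set0Pn=> s sS sX.
have [kap kapE] : exists kap : {set gT} -> nat,
    forall Y : {set gT}, #|Y * S| = kap Y + #|Y|.
  by exists (fun Y => #|Y * S| - #|Y|) => Y; rewrite subnK // (card_mulg_ge _ sS).
case: (arg_minnP kap sX) => Y sY minY.
pose P (M : {set gT}) := separating U S M && (kap M == kap Y).
have PY : P Y by rewrite /P sY eqxx.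
case: (arg_minnP (fun M : {set gT} => #|M|) PY) => M /andP[sM /eqP kM] minM.
have atM : atom U S M.
  split=> // Z sZ; have kYZ := minY Z sZ; first by rewrite !kapE kM; lia.
  by rewrite !kapE kM => kZM; apply: minM; rewrite /P sZ; apply/eqP; lia.
have /and3P[MU M1 _] := sM.
have /card_gt0P[m mM] : 0 < #|M| by lia.
exists (m^-1 *: M); first by apply/lcosetP; exists m; rewrite ?mulVg.
by apply: atom_lcoset; rewrite ?groupV ?(subsetP MU).
Qed.

(* The complement of [M * S] is, up to inversion, again separating with a
   deficiency at most that of [M]. *)
Lemma atom_card_compl (gT : finGroupType) (U : {group gT}) (S M : {set gT}) :
  abelian U -> S \subset U -> atom U S M -> #|M| + #|M * S| <= #|U|.
Proof.
move=> abU SU [/and3P[MU M1 MS] minM sizeM].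
have MSU : M * S \subset U by rewrite mul_subG.
have SVU : S^-1 \subset U by rewrite -(invGid U) invSg.
pose Y := U :\: (M * S).
have YU : Y \subset U by apply: subsetDl.
have cY : #|Y| = #|U| - #|M * S| by rewrite cardsD (setIidPr MSU).
have YSM : [disjoint Y * S^-1 & M].
  rewrite -setI_eq0; apply/eqP/setP=> x; rewrite !inE; apply/negP=> /andP[].
  case/mulsgP=> y t; rewrite !inE => /andP[/negP yMS _] tS -> ytM.
  by apply: yMS; apply/mulsgP; exists (y * t) t^-1; rewrite // mulgK.
have cYS : #|Y * S^-1| + #|M| <= #|U|.
  have [_] := leq_card_setU (Y * S^-1) M; rewrite YSM => /eqP <-.
  by rewrite subset_leq_card // subUset MU mul_subG.
have cZS : #|Y^-1 * S| = #|Y * S^-1|.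
  by rewrite -[S in LHS]invgK -invMg card_invg (mulg_abelianC abU SVU YU).
have sZ : separating U S Y^-1.
  by apply/and3P; split; [rewrite -(invGid U) invSg|rewrite card_invg|rewrite cZS]; lia.
have := minM _ sZ; have := sizeM _ sZ; rewrite cZS card_invg; lia.
Qed.

(** Submodularity of [#|X * S| - #|X|]: if [M != N], the intersection is separating and smaller than
    an atom, so its deficiency is strictly larger. The union then has a strictly smaller one, and
    [atom_card_compl] leaves room for it to be separating. *)
Lemma atom_meet (gT : finGroupType) (U : {group gT}) (S M N : {set gT}) :
  abelian U -> S \subset U -> atom U S M -> atom U S N -> 1 < #|M :&: N| ->
  M = N.
Proof.
move=> abU SU atM atN I1.
have [sM minM sizeM] := atM; have [sN minN sizeN] := atN.
have eMN := minM _ sN; have eNM := minN _ sM.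
have cMN := sizeM _ sN eNM; have cNM := sizeN _ sM eMN.
have cpl := atom_card_compl abU SU atM.
have /and3P[MU _ MS] := sM; have /and3P[NU _ NS] := sN.
apply/eqP; rewrite eqEcard cNM andbT; apply: contraT => nMN.
have ltI : #|M :&: N| < #|M|.
  by rewrite ltn_neqAle subset_leq_card ?subsetIl // andbT; apply: contra nMN => /eqP e;
    apply/setIidPl/eqP; rewrite eqEcard subsetIl e leqnn.
have subI : (M :&: N) * S \subset (M * S) :&: (N * S).
  by rewrite subsetI !mulSg ?subsetIl ?subsetIr.
have cI := subset_leq_card subI.
have sI : separating U S (M :&: N).
  apply/and3P; split=> //; first by rewrite (subset_trans (subsetIl _ _)).
  by have := subset_leq_card (subsetIl (M * S) (N * S)); lia.
have kI : #|M * S| + #|M :&: N| < #|(M :&: N) * S| + #|M|.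
  by rewrite ltnNge; apply: contraL ltI => /(sizeM _ sI); rewrite leqNgt.
have c1 := cardsUI (M * S) (N * S); have c2 := cardsUI M N.
have sMN : separating U S (M :|: N).
  by apply/and3P; split; [rewrite subUset MU NU| |rewrite mulUg];
     clear - I1 c1 c2 cI kI eMN eNM cMN cNM cpl ltI; lia.
have := minM _ sMN; rewrite mulUg.
by clear - I1 c1 c2 cI kI eMN eNM cMN cNM cpl ltI; lia.
Qed.

(** * Sidon atoms *)

(** Equivalently, ordered pairs of distinct elements of [M] have pairwise distinct quotients
    [x * y^-1]. *)
Definition sidon (gT : finGroupType) (M : {set gT}) :=
  forall g, g != 1 -> #|M :&: g *: M| <= 1.

(** A translate [g *: M] meeting [M] twice equals [M], so [g] is in [M]. For [a] in [M], both [1]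
    and [g] then lie in [a^-1 *: M], hence [M = a^-1 *: M], which is closure under products. *)
Lemma atom_group_or_sidon (gT : finGroupType) (U : {group gT}) (S M : {set gT}) :
  abelian U -> S \subset U -> atom U S M -> 1 \in M -> group_set M \/ sidon M.
Proof.
move=> abU SU atM M1.
have [sM _ _] := atM; have /and3P[MU _ _] := sM.
have [|nS] := boolP [forall g, (g != 1) ==> (#|M :&: g *: M| <= 1)].
  by move/forallP=> sid; right=> g g1; have := sid g; rewrite g1.
left; case/forallPn: nS => g; rewrite negb_imply -ltnNge => /andP[g1 gI].
have gU : g \in U.
  have /card_gt0P[x] : 0 < #|M :&: g *: M| by lia.
  rewrite inE => /andP[/(subsetP MU) xU /lcosetP[y /(subsetP MU) yU e]].
  by rewrite -(groupMr _ yU) -e.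
have eM : M = g *: M := atom_meet abU SU atM (atom_lcoset gU atM) gI.
have gM : g \in M by rewrite eM; apply/lcosetP; exists 1; rewrite ?mulg1.
apply/group_setP; split=> // a b aM bM.
have aU := subsetP MU a aM.
have eMa : M = a^-1 *: M.
  apply: (atom_meet abU SU atM); first by apply: atom_lcoset; rewrite ?groupV.
  suff sub : [set 1; g] \subset M :&: a^-1 *: M.
    by apply: leq_trans (subset_leq_card sub); rewrite cards2 eq_sym g1.
  apply/subsetP=> x; rewrite !inE => /orP[] /eqP ->; rewrite ?M1 ?gM /=.
    by apply/lcosetP; exists a; rewrite ?mulVg.
  apply/lcosetP; exists (a * g); last by rewrite mulKg.
  by rewrite (centsP abU a aU g gU) eM; apply/lcosetP; exists a.
by move: bM; rewrite {1}eMa => /lcosetP[c cM ->]; rewrite mulKVg.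
Qed.

Lemma sidon_lcoset_meet (gT : finGroupType) (M : {set gT}) x y :
  sidon M -> x != y -> #|x *: M :&: y *: M| <= 1.
Proof.
move=> sidM nxy.
have -> : x *: M :&: y *: M = x *: (M :&: (x^-1 * y) *: M).
  by apply/setP=> z; rewrite !(inE, mem_lcoset) invMg invgK !mulgA mulgK.
rewrite card_lcoset; apply: sidM; apply: contra nxy => /eqP e.
by rewrite -[y](mulKVg x) e mulg1.
Qed.

(* Each new translate of [M] meets the union of the previous ones in at most
   one point per previous translate. *)
Lemma sidon_card_mulg (gT : finGroupType) (M K : {set gT}) :
  sidon M -> 2 * (#|K| * #|M|) <= 2 * #|K * M| + #|K| * #|K|.-1.
Proof.
move=> sidM; have [n] := ubnP #|K|; elim: n K => // n IHn K ltKn.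
have [->|[k kK]] := set_0Vmem K; first by rewrite cards0.
have cK : #|K| = #|K :\ k|.+1 by rewrite (cardsD1 k K) kK.
set K' := K :\ k in cK *.
have IH : 2 * (#|K'| * #|M|) <= 2 * #|K' * M| + #|K'| * #|K'|.-1.
  by apply: IHn; lia.
have eKM : K * M = k *: M :|: K' * M by rewrite -{1}(setD1K kK) mulUg.
have cU := cardsUI (k *: M) (K' * M).
rewrite -eKM card_lcoset in cU.
suff cI : #|k *: M :&: K' * M| <= #|K'|.
  rewrite cK /=; move: #|K'| #|M| #|K * M| #|K' * M| #|k *: M :&: K' * M| IH cU cI; nia.
have meet x : x \in K' -> #|k *: M :&: x *: M| <= 1.
  by rewrite !inE => /andP[nxk _]; apply: sidon_lcoset_meet; rewrite // eq_sym.
(* [f] picks a translate through each common point, never reaching the default there; it is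
   injective because two translates share at most one point. *)
pose f z := odflt 1 [pick x in K' | z \in x *: M].
have fP z : z \in k *: M :&: K' * M -> f z \in K' /\ z \in f z *: M.
  rewrite inE => /andP[_ /mulsgP[x m xK' mM ez]]; rewrite /f.
  case: pickP => [y /andP[] //|/(_ x) /negP[]].
  by rewrite xK'; apply/lcosetP; exists m.
rewrite -(@card_in_imset _ _ f) => [|y z yI zI eyz].
  by apply/subset_leq_card/subsetP=> _ /imsetP[z /fP[fz _] ->].
have [[fy yf] [fz zf]] := (fP _ yI, fP _ zI).
move: yI zI; rewrite !inE => /andP[yk _] /andP[zk _].
by apply: (card_le1_eqP (meet _ fy)); rewrite inE ?yk ?zk // eyz.
Qed.

(** The smaller set serves as the set of translates in [sidon_card_mulg]. *)
Lemma sidon_pair_large (gT : finGroupType) (M N : {set gT}) :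
  sidon M -> sidon N -> N * M = M * N -> 1 < #|N| -> 2 < #|M| ->
  #|N| + #|M| <= #|N * M|.
Proof.
move=> sidM sidN eNM N2 M3.
have := sidon_card_mulg N sidM; have := sidon_card_mulg M sidN; rewrite -eNM.
move: #|N| #|M| #|N * M| N2 M3 => n m p; case: (leqP n m); nia.
Qed.

Lemma exists_neq1 (gT : finGroupType) (M : {set gT}) :
  1 < #|M| -> exists2 g, g \in M & g != 1.
Proof.
case/card_gt1P=> x [y [xM yM]]; have [->|x1 _] := eqVneq x 1; last by exists x.
by rewrite eq_sym; exists y.
Qed.

Lemma gen_mulg_sub (gT : finGroupType) (M T : {set gT}) :
  M * T \subset T -> <<M>> * T = T.
Proof.
move=> MT.
have stab t : t \in T -> forall x, x \in <<M>> -> x * t \in T.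
  (* In a finite group, [<<M>>] consists of products of elements of [M], without inverses. *)
  move=> tT x /gen_prodgP[n [c cM ->]]; elim: n c cM => [|n IHn] c cM.
    by rewrite big_ord0 mul1g.
  rewrite big_ord_recl -mulgA (subsetP MT) // mem_mulg ?IHn //.
apply/eqP; rewrite eqEsubset; apply/andP; split.
  by apply/subsetP=> _ /mulsgP[x t xM tT ->]; apply: stab.
by apply/subsetP=> t tT; rewrite -[t]mul1g mem_mulg.
Qed.

(* Some coset of [<<M>>] cuts out of [S] a piece which is still critical with
   [M], now inside the ambient group [<<M>>]. *)
Lemma sidon_atom_piece (gT : finGroupType) (U : {group gT}) (S M : {set gT}) :
  abelian U -> S \subset U -> atom U S M -> 1 \in M -> sidon M ->
  2 < #|M| -> #|M * S| < #|M| + #|S| ->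
  exists2 Y : {set gT}, separating <<M>> M Y & #|Y * M| < #|Y| + #|M|.
Proof.
move=> abU SU [sM minM sizeM] M1 sidM M3 crit.
have /and3P[MU _ MS] := sM.
pose K := <<M>>%G; have MK : M \subset K by apply: subset_gen.
have KU : K \subset U by rewrite gen_subG.
have MSU : M * S \subset U by rewrite mul_subG.
have SMS : S \subset M * S by rewrite -{1}[S]mul1g mulSg ?sub1set.
have MSKS : M * S \subset K * S by rewrite mulSg.
have KSU : K * S \subset U by rewrite mul_subG.
have M_lt_K : #|M| + 1 < #|K|.
  rewrite ltnNge; apply/negP=> leKM.
  have [g gM g1] := exists_neq1 (ltnW M3).
  have := cardsUI M (g *: M); rewrite card_lcoset.
  have : #|M :|: g *: M| <= #|K|.
    by apply: subset_leq_card; rewrite subUset MK mul_subG ?sub1set // (subsetP MK).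
  have := sidM g g1; clear -leKM M3; card_lia.
(* Otherwise [K] would be separating, with a deficiency below that of the atom [M]. *)
have KS_big : #|M * S| + 1 < #|K * S|.
  rewrite ltnNge; apply/negP=> leKS.
  have sK : separating U S K.
    apply/and3P; split=> //; first by card_lia.
    have [KSeU|] := eqVneq (K * S) U; first by move: leKS; rewrite KSeU; card_lia.
    rewrite eqEsubset KSU => /subsetPn[u uU uKS].
    have dis : [disjoint K * S & K :* u].
      rewrite -setI_eq0; apply/eqP/setP=> z; rewrite !inE.
      apply: contraNF uKS => /andP[/mulsgP[x s xK sS ->] /rcosetP[y yK e]].
      apply/mulsgP; exists (y^-1 * x) s => //; first by rewrite groupM ?groupV.
      by rewrite -mulgA e mulKg.
    have := leq_card_setU (K * S) (K :* u); rewrite dis => -[_ /eqP].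
    rewrite card_rcoset.
    have : #|K * S :|: K :* u| <= #|U|.
      by rewrite subset_leq_card // subUset KSU mul_subG ?sub1set.
    clear -M_lt_K leKS; card_lia.
  have := minM _ sK; clear -M_lt_K leKS; card_lia.
have [w] : exists w, w \in (K * S) :\: (M * S).
  by apply/card_gt0P; rewrite cardsD (setIidPr MSKS); clear -KS_big; card_lia.
rewrite inE => /andP[wMS wKS].
pose C := K :* w; pose T := S :&: C.
have wC : w \in C by apply: rcoset_refl.
have MC x y : x \in K -> (x * y \in C) = (y \in C).
  by move=> xK; rewrite !mem_rcoset -mulgA groupMl.
have MT : M * T = (M * S) :&: C.
  apply/setP=> z; apply/mulsgP/setIP=> [[x t xM /setIP[tS tC] ->]|].
    by rewrite mem_mulg // MC // (subsetP MK).
  case=> /mulsgP[x t xM tS ->]; rewrite MC ?(subsetP MK) // => tC.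
  by exists x t; rewrite // inE tS.
have TMT : T \subset M * T by rewrite -{1}[T]mul1g mulSg ?sub1set.
have MTC : M * T \subset C by rewrite MT subsetIr.
have wMT : w \notin M * T by rewrite MT inE (negPf wMS).
have diffT : #|M * T| - #|T| < #|M|.
  have sub : (M * T) :\: T \subset (M * S) :\: S.
    by rewrite MT /T; apply/subsetP=> z; rewrite !inE; case: (z \in C); rewrite ?andbF ?andbT.
  move: (subset_leq_card sub); rewrite !cardsD (setIidPr TMT) (setIidPr SMS).
  clear -crit M3; card_lia.
have [s sT] : exists s, s \in T.
  have /mulsgP[x s xK sS e] := wKS; exists s; rewrite inE sS /=.
  by rewrite -(MC x) // -e.
have [sS sC] := setIP sT.
(* If [T] were the single point [s], then [s] would arise in [M * S] only as [1 * s]. Removing [1]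
   from [M] would lose [s], giving a smaller set of no larger deficiency. *)
have T2 : 1 < #|T|.
  rewrite ltnNge; apply/negP=> T1.
  have cM : #|M| = #|M :\ 1|.+1 by rewrite (cardsD1 1) M1.
  have sD : s \notin (M :\ 1) * S.
    apply/mulsgP=> -[x t]; rewrite !inE => /andP[x1 xM] tS e.
    have tT : t \in T by rewrite inE tS -(MC x) ?(subsetP MK) // -e.
    have e' := card_le1_eqP T1 _ _ sT tT; case/eqP: x1.
    by apply: (mulIg t); rewrite -e mul1g.
  have sub : (M :\ 1) * S \proper M * S.
    apply/properP; split; first by rewrite mulSg // subsetDl.
    by exists s; rewrite ?(subsetP SMS).
  have lt := proper_card sub.
  have sM' : separating U S (M :\ 1).
    by apply/and3P; split; [by rewrite (subset_trans (subsetDl _ _))| |];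
      clear -MS lt cM M3; card_lia.
  have := sizeM _ sM'; clear -lt cM; card_lia.
(* Otherwise [M * T] accounts for all of [M * S] outside [S]. Then [S :\: C] is [K]-stable, so
   [K * S] exceeds [M * S] only inside [C], by at most one point, against [KS_big]. *)
have MT2 : #|M * T| + 1 < #|K|.
  rewrite ltnNge; apply/negP=> leK.
  have cC : #|C| = #|K| by rewrite card_rcoset.
  have cT : #|T| + #|M| <= #|K|.
    have dis : [disjoint T & M^-1 * [set w]].
      rewrite -setI_eq0; apply/eqP/setP=> z; rewrite in_setI in_set0.
      apply: contraNF wMT => /andP[zT /mulsgP[x _ xM /set1P-> e]].
      by apply/mulsgP; exists x^-1 z; [rewrite -mem_invg| |rewrite e mulKg].
    have := leq_card_setU T (M^-1 * [set w]); rewrite dis => -[_ /eqP].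
    rewrite card_rcoset card_invg => <-; rewrite -cC subset_leq_card // subUset.
    by rewrite subsetIr mulSg // -(invGid K) invSg.
  have ET : (M * S) :\: S = (M * T) :\: T.
    apply/esym/eqP; rewrite eqEcard; apply/andP; split.
      by rewrite MT /T; apply/subsetP=> z; rewrite !inE; case: (z \in C); rewrite ?andbF ?andbT.
    rewrite !cardsD (setIidPr TMT) (setIidPr SMS).
    have := subset_leq_card MTC.
    clear -crit cT leK cC M3; card_lia.
  have stabS : K * (S :\: C) = S :\: C.
    apply: gen_mulg_sub; apply/subsetP=> _ /mulsgP[x t xM /setDP[tS tC] ->].
    have xtC : x * t \notin C by rewrite MC // (subsetP MK).
    rewrite inE xtC /=; apply: contraR xtC => nS.
    have : x * t \in (M * S) :\: S by rewrite inE nS mem_mulg.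
    by rewrite ET inE => /andP[_ /(subsetP MTC)].
  have sub : (K * S) :\: (M * S) \subset C :\: (M * T).
    apply/subsetP=> z /setDP[/mulsgP[x t xK tS ->] nMS].
    rewrite MT !inE negb_and nMS /= MC //; apply: contraR nMS => tC.
    apply: (subsetP SMS); have : x * t \in K * (S :\: C) by rewrite mem_mulg // inE tC.
    by rewrite stabS => /setDP[].
  have := subset_leq_card sub; rewrite !cardsD (setIidPr MSKS) (setIidPr MTC).
  clear -cC leK KS_big; card_lia.
have TU : T \subset U by rewrite (subset_trans (subsetIl _ _)).
have eY : #|(T :* s^-1) * M| = #|M * T|.
  have sU := subsetP SU s sS.
  rewrite (mulg_abelianC abU) // ?mulgA ?card_rcoset //.
  by rewrite mul_subG ?sub1set ?groupV.
exists (T :* s^-1); last by rewrite eY card_rcoset; clear -diffT M3; card_lia.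
apply/and3P; split; rewrite ?eY ?card_rcoset //.
apply/subsetP=> _ /rcosetP[t tT ->]; have [_ tC] := setIP tT.
move: tC sC; rewrite !mem_rcoset => tw sw.
have -> : t * s^-1 = (t * w^-1) * (s * w^-1)^-1 by rewrite invMg invgK mulgA mulgKV.
by rewrite (groupM tw) // groupV.
Qed.

(* Hamidoune's description of the 2-atoms of a critical pair. *)
Theorem critical_pair_atom (gT : finGroupType) (U : {group gT})
    (S X : {set gT}) :
  abelian U -> S \subset U -> S != set0 -> separating U S X ->
  #|X * S| < #|X| + #|S| ->
  exists M : {set gT}, [/\ 1 \in M, separating U S M,
    #|M * S| < #|M| + #|S| & group_set M \/ #|M| = 2].
Proof.
move=> abU SU S0 sX crit.
have [M M1 atM] := exists_atom S0 sX.
have [sM minM _] := atM; have /and3P[MU M2 _] := sM.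
have critM : #|M * S| < #|M| + #|S| by have := minM _ sX; clear -crit; card_lia.
exists M; split=> //.
have [|sidM] := atom_group_or_sidon abU SU atM M1; [by left | right].
apply/eqP; rewrite eqn_leq M2 andbT leqNgt; apply/negP=> M3.
(* Now [M] is critical inside its own group; an atom [N] for [M] there is again a subgroup or
   Sidon. *)
have [Y sY critY] := sidon_atom_piece abU SU atM M1 sidM M3 critM.
have abK : abelian <<M>> by apply: abelianS abU; rewrite gen_subG.
have M0 : M != set0 by apply/set0Pn; exists 1.
have [N N1 atN] := exists_atom M0 sY.
have [sN minN _] := atN; have /and3P[NK N2 NM] := sN.
have critN : #|N * M| < #|N| + #|M| by have := minN _ sY; clear -critY; card_lia.
have MK := subset_gen M.
have [grN|sidN] := atom_group_or_sidon abK MK atN N1; last first.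
  have := sidon_pair_large sidM sidN (mulg_abelianC abK NK MK) N2 M3.
  by rewrite leqNgt critN.
pose H := Group grN; have eN : N = H by [].
have [g gN g1] := exists_neq1 N2.
have cMN : #|M| <= #|N|.
  have sub : M :|: g *: M \subset N * M.
    by rewrite subUset -{1}[M]mul1g !mulSg ?sub1set.
  have := cardsUI M (g *: M); rewrite card_lcoset.
  have := subset_leq_card sub; have := sidM g g1; clear -critN; card_lia.
(* A point of [M] outside [N] would put two cosets of [N] in [N * M]. Once [M] lies in [N], so does
   [<<M>>], and [N] is too large to be separating. *)
have sMN : M \subset N.
  apply/subsetP=> x xM; apply: contraLR critN => xN; rewrite -leqNgt.
  have dis : [disjoint N & N :* x].
    rewrite -setI_eq0; apply/eqP/setP=> z; rewrite !inE.
    apply: contraNF xN => /andP[zN /rcosetP[y yN e]].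
    by move: zN; rewrite e eN groupMl.
  have := leq_card_setU N (N :* x); rewrite dis => -[_ /eqP].
  rewrite card_rcoset.
  have : #|N :|: N :* x| <= #|N * M|.
    by rewrite subset_leq_card // subUset -{1}[N]mulg1 !mulgS ?sub1set.
  clear -cMN; card_lia.
have : #|<<M>>| <= #|N| by rewrite subset_leq_card // eN gen_subG.
have := card_mulg_ge N M1; clear -NM; card_lia.
Qed.

(** * Sum-free sets with no sum-free quotient *)

(** The element [z = a * b^-1 * h] carries [b *: H] onto [a *: H]. If [z *: (A :&: b *: H)] missed
    [A], these two distinct cosets would contain at least [#|H|] holes of [A]. *)
Lemma holes_pigeonhole (gT : finGroupType) (H : {group gT}) (A : {set gT}) a b h :
  abelian [set: gT] -> #|A * H| < #|A| + #|H| -> a \in A -> b \in A ->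
  a * b^-1 \notin H -> h \in H -> a * b^-1 * h \in A * A^-1.
Proof.
move=> abG few aA bA nab hH.
have mC (x y : gT) : x * y = y * x by apply: (centsP abG); rewrite inE.
set z := a * b^-1 * h.
have zB : z *: (b *: H) = a *: H.
  by rewrite -lcosetM /z -mulgA (mC h) mulgA mulgKV lcosetM lcoset_id.
suff /set0Pn[x] : (A :&: a *: H) :&: z *: (A :&: b *: H) != set0.
  rewrite !inE => /andP[/andP[xA _] /lcosetP[y /setIP[yA _] e]].
  by apply/mulsgP; exists x y^-1; rewrite ?inE ?invgK // e mulgK.
apply/eqP=> I0.
have cU := cardsUI (A :&: a *: H) (z *: (A :&: b *: H)).
rewrite I0 cards0 card_lcoset in cU.
have cU2 := cardsUI ((a *: H) :\: A) ((b *: H) :\: A).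
have dis : ((a *: H) :\: A) :&: ((b *: H) :\: A) = set0.
  apply/setP=> x; rewrite !inE !mem_lcoset; apply: contraNF nab.
  case/andP=> /andP[_ ax] /andP[_ bx].
  have -> : a * b^-1 = (b^-1 * x) * (a^-1 * x)^-1.
    by rewrite invMg invgK !mulgA mulgK mC.
  by rewrite groupM // groupV.
rewrite dis cards0 in cU2.
have s1 : A :&: a *: H :|: z *: (A :&: b *: H) \subset a *: H.
  rewrite subUset subsetIr /=; apply/subsetP=> x /lcosetP[y /setIP[_ yb] ->].
  by rewrite -zB; apply/lcosetP; exists y.
have s2 : ((a *: H) :\: A) :|: ((b *: H) :\: A) \subset (A * H) :\: A.
  by rewrite -setDUl setSD // subUset !mulSg ?sub1set.
have sA : A \subset A * H by rewrite mulG_subl.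
have := subset_leq_card s1; have := subset_leq_card s2.
have := cardsID A (a *: H); have := cardsID A (b *: H).
rewrite (setIC _ A) (setIC _ A) !card_lcoset in cU cU2 *.
rewrite [#|A * H :\: A|]cardsD (setIidPr sA).
have := cardG_gt0 H; clear -few cU cU2; card_lia.
Qed.

(** In [a * b * c^-1 * h], a quotient [a * c^-1] or [b * c^-1] outside [H] absorbs [h] by
    [holes_pigeonhole]. If both are in [H], some [e] in [A] has [a * e^-1] outside [H], and
    [a * e^-1] absorbs [b * c^-1 * h]; multiply back by [e]. *)
Lemma few_holes_periodic (gT : finGroupType) (H : {group gT}) (A : {set gT}) :
  abelian [set: gT] -> 1 \in A -> ~~ (A \subset H) -> #|A * H| < #|A| + #|H| ->
  A * A * A^-1 * H = A * A * A^-1.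
Proof.
move=> abG A1 nAH few.
have mC (x y : gT) : x * y = y * x by apply: (centsP abG); rewrite inE.
have pg a b h := @holes_pigeonhole _ H A a b h abG few.
have mem3 u e : u \in A * A^-1 -> e \in A -> u * e \in A * A * A^-1.
  case/mulsgP=> a b aA bA -> eA; apply/mulsgP; exists (a * e) b => //.
    by rewrite mem_mulg.
  by rewrite -!mulgA (mC b).
apply/eqP; rewrite eqEsubset mulG_subl andbT; apply/subsetP=> u.
case/mulsgP=> _ h /mulsgP[_ c' /mulsgP[a b aA bA ->] cA ->] hH ->.
rewrite inE in cA; move: cA; rewrite -[c' in X in _ * X * h]invgK.
move: (c'^-1) => {c'} c cA.
have [acH|nac] := boolP (a * c^-1 \in H); last first.
  by have := mem3 _ _ (pg a c h aA cA nac hH) bA; rewrite -!mulgA (mC b) !mulgA.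
have [bcH|nbc] := boolP (b * c^-1 \in H); last first.
  by have := mem3 _ _ (pg b c h bA cA nbc hH) aA; rewrite (mC _ a) !mulgA.
have [e eA nae] : exists2 e, e \in A & a * e^-1 \notin H.
  have [aH|naH] := boolP (a \in H); last by exists 1; rewrite // invg1 mulg1.
  by case/subsetPn: nAH => e eA neH; exists e; rewrite // groupMl // groupV.
have hbc : b * c^-1 * h \in H by rewrite groupM.
have := mem3 _ e (pg a e (b * c^-1 * h) aA eA nae hbc) eA.
by rewrite (mC _ e) !mulgA (mC e a) mulgK.
Qed.

(** * Growth of products, and sets critical with a pair *)

Lemma card_mul_avoid (gT : finGroupType) (U : {group gT}) (X B : {set gT}) x0 :
  x0 \in U -> X \subset U -> B \subset U -> x0 \notin X * B ->
  #|X| + #|B| <= #|U|.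
Proof.
move=> x0U XU BU nx0.
have dis : [disjoint X & x0 *: B^-1].
  rewrite -setI_eq0; apply/eqP/setP=> z; rewrite !inE.
  apply: contraNF nx0 => /andP[zX /lcosetP[b bB e]].
  by apply/mulsgP; exists z b^-1; rewrite -?mem_invg // e mulgK.
have := leq_card_setU X (x0 *: B^-1); rewrite dis => -[_ /eqP].
rewrite card_lcoset card_invg => <-; rewrite subset_leq_card // subUset XU.
by rewrite mul_subG ?sub1set // -(invGid U) invSg.
Qed.

(** The last factor is counted by [card_mul_avoid]. Since [m > 1], the bound for the later factors
    leaves two points of [U] outside [X * B], so [X] is separating and the growth hypothesis
    applies. *)
Lemma growth_card (gT : finGroupType) (U : {group gT}) (m : nat) x0
    (Bs : seq {set gT}) (X : {set gT}) :
  x0 \in U -> 1 < m ->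
  (forall B : {set gT}, B \in Bs -> [/\ B \subset U, 1 \in B, #|B| = m &
     forall Y, separating U B Y -> #|Y| + #|B| <= #|Y * B|]) ->
  Bs != [::] -> X \subset U -> 1 < #|X| -> x0 \notin X * \prod_(B <- Bs) B ->
  (#|X| + size Bs * m <= #|U|)%N.
Proof.
move=> x0U m1; elim: Bs X => // B Bs IHBs X hB _ XU X2.
have [BU B1 cB growB] := hB B (mem_head _ _).
rewrite big_cons mulgA => nx0.
have [Bs0|Bs0] := eqVneq Bs [::].
  move: nx0; rewrite Bs0 big_nil mulg1 /= mul1n -cB.
  exact: card_mul_avoid.
have cXB : #|X| <= #|X * B| by apply: card_mulg_ge B1.
have := IHBs (X * B) (fun C CBs => hB C (mem_behead (s := B :: Bs) CBs)) Bs0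
  (mul_subG XU BU) (leq_trans X2 cXB) nx0.
have szBs : 0 < size Bs by rewrite lt0n size_eq0.
have : #|X * B| + 1 < #|U| -> #|X| + #|B| <= #|X * B|.
  by move=> lt; apply: growB; apply/and3P.
rewrite cB /= mulSn.
clear -szBs m1 X2; move: (size Bs) #|X| #|X * B| #|U| X2 szBs => s a b u; nia.
Qed.

(* The points of [A] not in [x *: A] are the starts of the arcs of [A] on the
   cosets of [<[x]>]. *)
Lemma pair_one_start (gT : finGroupType) (A : {set gT}) x :
  #|[set 1; x] * A| <= #|A| + 1 ->
  forall a b, a \in A -> b \in A -> x^-1 * a \notin A -> x^-1 * b \notin A -> a = b.
Proof.
move=> cA a b aA bA na nb.
have e : [set 1; x] * A = A :|: x *: A by rewrite mulUg mul1g.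
have c1 := cardsUI A (x *: A); rewrite -e card_lcoset in c1.
have c2 := cardsID (x *: A) A.
have le1 : #|A :\: x *: A| <= 1 by clear -c1 c2 cA; card_lia.
by apply: (card_le1_eqP le1); rewrite inE mem_lcoset ?na ?nb.
Qed.

(** Cosets of [<[x]>] without a start are full or empty. At most one coset has a start [y], and its
    holes exclude [y]. *)
Lemma pair_few_holes (gT : finGroupType) (A : {set gT}) x :
  abelian [set: gT] -> #|[set 1; x] * A| <= #|A| + 1 ->
  #|A * <[x]>| < #|A| + #|<[x]>|.
Proof.
move=> abG cA; have start := pair_one_start cA.
have mC (u v : gT) : u * v = v * u by apply: (centsP abG); rewrite inE.
have mCs (X Y : {set gT}) : X * Y = Y * X by apply: mulg_abelianC abG _ _; rewrite subsetT.
have per (T : {set gT}) : (forall t, t \in T -> x^-1 * t \in T) -> <[x]> * T = T.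
  move=> hT; rewrite -cycleV; apply: gen_mulg_sub.
  by apply/subsetP=> _ /mulsgP[_ t /set1P-> tT ->]; apply: hT.
have [|[y]] := set_0Vmem [set a in A | x^-1 * a \notin A].
  move=> S0; rewrite mCs per; first by have := cardG_gt0 <[x]>; clear; card_lia.
  by move=> t tA; apply: contraT => nt; rewrite -(in_set0 t) -S0 inE tA.
rewrite inE => /andP[yA ny].
pose T := A :\: y *: <[x]>.
have TT : <[x]> * T = T.
  apply: per => t; rewrite !inE !mem_lcoset => /andP[ty tA]; apply/andP; split.
    by apply: contra ty => h; rewrite -[t](mulKVg x) (mC x) mulgA groupM ?cycle_id.
  apply: contraR ty => nt; rewrite (start t y) // mulVg group1 //.
have sub : (A * <[x]>) :\: A \subset (y *: <[x]>) :\ y.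
  apply/subsetP=> z /setDP[/mulsgP[a h aA hx ->] nA].
  rewrite !inE mem_lcoset; apply/andP; split.
    by apply: contra nA => /eqP ->.
  rewrite mulgA groupMr //; apply: contraR nA => nay.
  have : h * a \in <[x]> * T by rewrite mem_mulg // !inE mem_lcoset nay.
  by rewrite TT mC inE => /andP[].
have sA : A \subset A * <[x]> by rewrite mulG_subl.
have := subset_leq_card sub; have := cardsD1 y (y *: <[x]>).
rewrite mem_lcoset mulVg group1 card_lcoset !cardsD (setIidPr sA).
clear; card_lia.
Qed.

(** A start [y] exists since [A] is a nonempty proper part of [<[x]>]. As it is the only one, the
    exponents [i < #[x]] with [y * x ^+ i] in [A] are closed downwards. *)
Lemma pair_progression (gT : finGroupType) (A : {set gT}) x :
  A \subset <[x]> -> #|A| < #[x] -> A != set0 -> #|[set 1; x] * A| <= #|A| + 1 ->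
  exists2 y, y \in A & forall i, i < #|A| -> y * x ^+ i \in A.
Proof.
move=> Ax cAx A0 cA; have start := pair_one_start cA.
have mC (u v : gT) : u \in <[x]> -> v \in <[x]> -> u * v = v * u.
  by move=> ux vx; apply: (centsP (cycle_abelian x)).
have [|[y]] := set_0Vmem [set a in A | x^-1 * a \notin A].
  move=> S0; have := @gen_mulg_sub _ [set x^-1] A.
  rewrite -[<<_>>]/<[x^-1]> cycleV => H.
  have [a aA] := set0Pn _ A0.
  have /H e : [set x^-1] * A \subset A.
    apply/subsetP=> _ /mulsgP[_ t /set1P-> tA ->].
    by apply: contraT => nt; rewrite -(in_set0 t) -S0 inE tA.
  have := card_mulg_ge <[x]> aA; rewrite e -[#|<[x]>|]/(#[x]).
  by rewrite leqNgt cAx.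
rewrite inE => /andP[yA ny]; exists y => //.
have yx := subsetP Ax y yA.
pose f (i : 'I_#[x]) := y * x ^+ i.
pose J := [set i | f i \in A].
have f_inj : injective f.
  move=> i j /mulgI /eqP; rewrite eq_expg_mod_order !modn_small // => /eqP.
  exact: val_inj.
have cJ : #|A| = #|J|.
  have eA : A = f @: J.
    apply/setP=> a; apply/idP/imsetP=> [aA|[i]]; last by rewrite inE => ? ->.
    have : y^-1 * a \in <[x]> by rewrite groupM ?groupV // (subsetP Ax).
    case/cyclePmin=> i ilt e; exists (Ordinal ilt); rewrite ?inE /f /= -e mulKVg //.
  by rewrite {1}eA card_imset.
have down i : i.+1 < #[x] -> y * x ^+ i.+1 \in A -> y * x ^+ i \in A.
  move=> ilt iA; apply: contraT => ni.
  have : y * x ^+ i.+1 = y.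
    apply: start => //; rewrite mC ?groupV ?cycle_id //; last first.
      by rewrite groupM // mem_cycle.
    by rewrite expgSr mulgA mulgK.
  move/eqP; rewrite -{2}[y]mulg1 (inj_eq (mulgI y)) -order_dvdn.
  by rewrite gtnNdvd.
have downs i j : i <= j -> j < #[x] -> y * x ^+ j \in A -> y * x ^+ i \in A.
  move=> /subnKC <-; elim: (j - i)%N => [|n IHn]; rewrite ?addn0 // addnS => lt h.
  by apply: IHn; [apply: ltnW | apply: down].
move=> i im; apply: contraT => ni.
have sub : J \subset [set j : 'I_#[x] | j < i].
  apply/subsetP=> j; rewrite !inE => jA; rewrite ltnNge; apply: contra ni => ij.
  exact: downs ij (ltn_ord j) jA.
have := subset_leq_card sub; rewrite -cJ leqNgt.
suff -> : #|[set j : 'I_#[x] | j < i]| = i by rewrite im.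
have iq := ltn_trans im cAx.
have widen_inj : injective (widen_ord (ltnW iq)).
  by move=> a b /(congr1 val) /= e; apply: val_inj.
rewrite -[RHS]card_ord -(card_imset _ widen_inj).
apply: eq_card => j; rewrite inE; apply/idP/imsetP=> [ji|[j' _ ->] /=]; last exact: ltn_ord.
by exists (Ordinal ji) => //; apply: val_inj.
Qed.

Lemma subset_setX (gT : finGroupType) (U : {group gT}) (B : {set gT}) n :
  B \subset U -> B ^+ n \subset U.
Proof.
move=> BU; elim: n => [|n IHn]; first by rewrite expg0 sub1G.
by rewrite expgS mul_subG.
Qed.

Lemma mem_setX (gT : finGroupType) (B : {set gT}) x n :
  x \in B -> x ^+ n \in B ^+ n.
Proof.
move=> xB; elim: n => [|n IHn]; first by rewrite !expg0 inE.
by rewrite !expgS mem_mulg.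
Qed.

Lemma set1X (gT : finGroupType) (x : gT) n : [set x] ^+ n = [set x ^+ n].
Proof. by elim: n => [|n IHn]; rewrite ?expg0 // !expgS IHn mulg_set1. Qed.

Lemma setXV (gT : finGroupType) (B : {set gT}) n : B^-1 ^+ n = (B ^+ n)^-1.
Proof. by elim: n => [|n IHn]; rewrite ?expg0 ?invg1 // expgS expgSr invMg IHn. Qed.

Lemma prod_nseq_setX (gT : finGroupType) (B : {set gT}) n :
  \prod_(C <- nseq n B) C = B ^+ n.
Proof. by elim: n => [|n IHn] /=; rewrite ?big_nil // big_cons IHn expgS. Qed.

Lemma progression_setX (gT : finGroupType) (B : {set gT}) y x m n j :
  abelian [set: gT] -> (forall i, i <= m -> y * x ^+ i \in B) -> j <= n * m ->
  y ^+ n * x ^+ j \in B ^+ n.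
Proof.
move=> abG hB.
have mC (u v : gT) : u * v = v * u by apply: (centsP abG); rewrite inE.
elim: n j => [|n IHn] j; first by rewrite leqn0 => /eqP ->; rewrite !expg0 mulg1 inE.
move=> jm; have [i im [j' jm' ->]] : exists2 i, i <= m & exists2 j', j' <= n * m & j = (i + j')%N.
  by exists (minn j m); [rewrite geq_minr | exists (j - minn j m)%N; lia].
rewrite !expgS expgD -!mulgA (mulgA _ (x ^+ i)) (mC _ (x ^+ i)) -!mulgA mulgA.
by rewrite mem_mulg ?hB ?IHn.
Qed.

(** The first multiple of [delta] above [l * m.-1] exceeds it by at most [k - l], and both
    alternatives leave that much room: the first comes from growth, the second from a progression in
    a proper subgroup of order [q]. *)
Lemma interval_of_card (d k l m q : nat) : 0 < l -> l < k -> 1 < m ->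
  ((k + l) * m <= d \/ (2 * q <= d /\ (k + l) * m.-1 < q)) ->
  exists w, [/\ delta k l d %| w, (l * m.-1 < w)%N & (w + k * m.-1 < d)%N].
Proof.
move=> l0 lk m1 hd; have ck := delta_le d lk.
have [w cw] := exists_dvdn_gt (l * m.-1) (delta_gt0 d lk).
move: (delta k l d) cw ck => c cw ck lw; exists w; split=> //; first by lia.
case: m m1 hd lw => [|[|m]] //= _; nia.
Qed.

(* When a proper quotient would already be sum-free the bound follows by
   induction; this is the remaining case. *)
Lemma interval_of_aperiodic (gT : finGroupType) (A : {set gT}) k l :
  abelian [set: gT] -> 0 < l -> l < k -> A != set0 ->
  1 \notin A ^+ k * A^-1 ^+ l ->
  (forall H : {group gT}, H :!=: 1 -> 1 \in A ^+ k * A^-1 ^+ l * H) ->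
  exists w, [/\ delta k l #|gT| %| w, (l * #|A|.-1 < w)%N & (w + k * #|A|.-1 < #|gT|)%N].
Proof.
move=> abG l0 lk /set0Pn[c cA].
have mC (u v : gT) : u * v = v * u by apply: (centsP abG); rewrite inE.
have mCs (X Y : {set gT}) : X * Y = Y * X by apply: mulg_abelianC abG _ _; rewrite subsetT.
have mACA (P Q R S : {set gT}) : P * Q * (R * S) = P * R * (Q * S).
  by rewrite !mulgA -(mulgA P Q) (mCs Q) !mulgA.
have [B [eA B1 cB]] : exists B : {set gT}, [/\ A = [set c] * B, 1 \in B & #|A| = #|B|].
  exists (c^-1 *: A); split; last by rewrite card_lcoset.
    by rewrite mulgA mulg_set1 mulgV mul1g.
  by apply/lcosetP; exists c; rewrite ?mulVg.
pose Z := B ^+ k * B^-1 ^+ l.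
have expgB u : u ^+ k * u^-1 ^+ l = u ^+ (k - l) :> gT.
  by rewrite -{1}(subnK (ltnW lk)) expgD expVgn mulgK.
pose x0 := (c ^+ (k - l))^-1.
have eZ : A ^+ k * A^-1 ^+ l = x0^-1 *: Z.
  rewrite eA invMg (mCs B^-1) !expgMn; try exact: mCs.
  rewrite mACA invg_set1 !set1X mulg_set1.
  by rewrite expgB /x0 invgK.
rewrite eZ => /negP nZ perZ.
have {}nZ : x0 \notin Z.
  by apply/negP=> h; case: nZ; rewrite mem_lcoset invgK mulg1.
have {}perZ (H : {group gT}) : H :!=: 1 -> x0 \in Z * H.
  by move/perZ; rewrite -mulgA mem_lcoset invgK mulg1.
have BV1 : 1 \in B^-1 by rewrite inE invg1.
have Z1 : 1 \in Z.
  have := mem_mulg (mem_setX k B1) (mem_setX l BV1).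
  by rewrite !expg1n mulg1.
rewrite cB; have [B_le1|m1] := leqP #|B| 1.
  have -> : #|B| = 1%N by apply/eqP; rewrite eqn_leq B_le1; apply/card_gt0P; exists 1.
  (* For a singleton [w = delta] works: [delta = #|gT|] would force [x0 = 1], a point of [Z]. *)
  rewrite !muln0; exists (delta k l #|gT|); rewrite dvdnn delta_gt0 // addn0; split=> //.
  rewrite ltn_neqAle dvdn_leq ?dvdn_gcdl ?andbT; last 2 first.
  - by apply/card_gt0P; exists 1.
  - by [].
  apply: contra nZ => /eqP e.
  have /dvdnP[e' ee] : #|gT| %| k - l by rewrite -e dvdn_gcdr.
  have cG : c ^+ #|gT| = 1 by rewrite -cardsT expg_cardG ?inE.
  by rewrite /x0 ee mulnC expgM cG expg1n invg1.
pose U := <<B>>%G; have BU : B \subset U by apply: subset_gen.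
have BVU : B^-1 \subset U by rewrite -(invGid U) invSg.
have ZU : Z \subset U by rewrite mul_subG ?subset_setX.
have x0U : x0 \in U.
  have [U1|/perZ] := eqVneq (gval U) 1; last by apply/subsetP; rewrite mul_subG.
  by have := subset_leq_card BU; rewrite U1 cards1 leqNgt m1.
(* As [k >= 2] and [l >= 1], [Z] has a factor [B * B * B^-1]. If it is [H]-periodic, so is [Z], and
   [perZ] puts [x0] in [Z]. *)
have noholes (H : {group gT}) : 1 < #|H| -> #|B * H| < #|B| + #|H| -> B \subset H.
  rewrite cardG_gt1 => /perZ x0ZH few; apply: contraR nZ => nBH.
  have BBB := few_holes_periodic abG B1 nBH few.
  suff ZH : Z * H = Z by rewrite -ZH.
  rewrite /Z -(subnK (leq_ltn_trans l0 lk)) -(subnK l0) (expgD B) (expgD B^-1).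
  rewrite expg1 expgS expg1 !(mCs (_ ^+ (_ - _)) _) (mACA (B * B)) -mulgA (mCs _ H).
  by rewrite mulgA BBB.
have [/existsP[X /andP[sX crit]]|/existsPn grow] :=
    boolP [exists X : {set gT}, separating U B X && (#|X * B| < #|X| + #|B|)].
  have B0 : B != set0 by apply/set0Pn; exists 1.
  have abU : abelian U by apply: abelianS abG; rewrite subsetT.
  have [M [M1 sM critM [gM|M2]]] := critical_pair_atom abU BU B0 sX crit.
    have /and3P[MU M1' MB] := sM; pose H := Group gM.
    have BH : B \subset H.
      by apply: noholes => //=; rewrite mCs addnC.
    have UH : U \subset H by rewrite gen_subG.
    have := subset_leq_card UH; have := card_mulg_ge M B1 => /=.
    clear -MB; card_lia.
  have [x x1 eM] : exists2 x, x != 1 & M = [set 1; x].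
    have /cards2P[u [v [nuv e]]] : #|M| == 2 by rewrite M2.
    have [u1|u1] := eqVneq u 1; first by exists v; rewrite -?u1 // eq_sym.
    exists u => //; move: M1; rewrite e !inE eq_sym (negPf u1) /= => /eqP <-.
    by rewrite setUC.
  have /and3P[MU _ MB] := sM; rewrite M2 in critM; rewrite eM in critM MB MU.
  have {}critM : #|[set 1; x] * B| <= #|B| + 1 by clear -critM; card_lia.
  have Bx : B \subset <[x]>.
    apply: noholes; last exact: pair_few_holes.
    by rewrite cardG_gt1 cycle_eq1.
  have xU : x \in U by apply: (subsetP MU); rewrite !inE eqxx orbT.
  have eU : U = <[x]> :> {set gT}.
    by apply/eqP; rewrite eqEsubset gen_subG Bx cycle_subG.
  have cU : #|U| = #[x] by rewrite eU.
  have ltB : #|B| < #[x].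
    rewrite -cU; have := card_mulg_ge B (set21 1 x); rewrite mCs.
    by clear -MB; card_lia.
  have [y yB prog] := pair_progression Bx ltB B0 critM.
  have prog' i : i <= #|B|.-1 -> y * x ^+ i \in B.
    by move=> le_i; apply: prog; rewrite (leq_ltn_trans le_i) // prednK // ltnW.
  have yx : y \in <[x]> := subsetP Bx y yB.
  (* This exponent [w] locates the progression: [avoid] says that [w + i - j] is never [0] modulo
     [#[x]]. *)
  have /cyclePmin[w wq es] : (c * y) ^+ (k - l) \in <[x]>.
    rewrite -eU expgMn; last exact: mC.
    apply: groupM; first by rewrite -groupV.
    by apply: groupX; rewrite (subsetP BU).
  have avoid i j : i <= k * #|B|.-1 -> j <= l * #|B|.-1 ->
      x ^+ w * x ^+ i * x ^- j != 1.
    move=> ik jl; apply: contra nZ => /eqP e.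
    have jB : (y ^+ l * x ^+ j)^-1 \in B^-1 ^+ l.
      by rewrite setXV inE invgK (progression_setX abG prog').
    have := mem_mulg (progression_setX abG prog' ik) jB.
    suff -> : y ^+ k * x ^+ i * (y ^+ l * x ^+ j)^-1 = x0 by [].
    rewrite -[x0]mulg1 -e -es expgMn; last exact: mC.
    rewrite -{1}(subnK (ltnW lk)) expgD invMg !mulgA mulVg mul1g.
    by rewrite -!mulgA (mC (y ^+ l)) -!mulgA mulVg mulg1.
  have w_gt : l * #|B|.-1 < w.
    rewrite ltnNge; apply/negP=> /(avoid 0 w (leq0n _)).
    by rewrite expg0 mulg1 mulgV eqxx.
  have w_lt : w + k * #|B|.-1 < #[x].
    rewrite ltnNge; apply/negP=> le_q.
    have /avoid/(_ (leq0n _)) : #[x] - w <= k * #|B|.-1 by rewrite leq_subLR.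
    by rewrite expg0 invg1 mulg1 -expgD subnKC ?(ltnW wq) // expg_order eqxx.
  (* If [x] generates the whole group, [c * y] is a power of [x], so [delta] divides [w]. Otherwise
     [#[x]] is at most half of [#|gT|], and [interval_of_card] supplies another witness. *)
  have [Ud|nUd] := eqVneq #[x] #|gT|.
    exists w; split=> //; last by rewrite -Ud.
    have /cycleP[e ee] : c * y \in <[x]>.
      have -> : <[x]> = [set: gT].
        by apply/eqP; rewrite eqEcard subsetT cardsT -Ud leqnn.
      by rewrite inE.
    move/eqP: es; rewrite ee -expgM eq_expg_mod_order -Ud => /eqP es.
    have dd : delta k l #[x] %| #[x] by rewrite dvdn_gcdl.
    rewrite /dvdn -(modn_dvdm _ dd) -es (modn_dvdm _ dd) -/(dvdn _ _).
    by rewrite dvdn_mull // dvdn_gcdr.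
  apply: (@interval_of_card _ k l #|B| #[x]) => //; right.
  have /dvdnP[e ee] : #[x] %| #|gT| by rewrite -cardsT order_dvdG // inE.
  split; last by clear -w_gt w_lt; move: #|B|.-1 #[x] w_gt w_lt => a b; nia.
  rewrite ee leq_mul2r; apply/orP; right.
  case: e ee nUd => [|[|//]] ee; last by rewrite ee mul1n eqxx.
  by move: ee; rewrite mul0n => /card0_eq/(_ 1); rewrite inE.
apply: (@interval_of_card _ k l #|B| 0) => //; left.
have growB Y : separating U B Y -> #|Y| + #|B| <= #|Y * B|.
  by move=> sY; have := grow Y; rewrite sY /= -leqNgt.
(* One factor [B] of [Z] is the starting set, hence [k.-1] further copies. *)
have := @growth_card _ U #|B| x0 (nseq k.-1 B ++ nseq l B^-1) B x0U m1 _ _ BU m1.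
rewrite big_cat /= !prod_nseq_setX mulgA -expgS prednK ?(leq_ltn_trans _ lk) //.
rewrite size_cat !size_nseq => H.
have : #|B| + (k.-1 + l) * #|B| <= #|U|.
  apply: H => //; last by case: (l) l0 => // l' _; case: (k.-1).
  move=> C; rewrite mem_cat => /orP[] /nseqP[-> _]; split=> //.
    by rewrite card_invg.
  move=> Y sY; have eY : #|Y * B^-1| = #|Y^-1 * B| by rewrite -card_invg invMg invgK mCs.
  rewrite eY !card_invg; rewrite -(card_invg Y); apply: growB.
  have /and3P[YU Y2 YB] := sY; apply/and3P; split.
  - by rewrite -(invGid U) invSg. - by rewrite card_invg. - by rewrite -eY.
have : #|U| <= #|gT| by rewrite max_card.
have : 0 < k by apply: leq_ltn_trans lk.
clear; move: #|B| #|U| #|gT| => a b c'; case: k => // k' _ /= h; nia.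
Qed.

(** * The formula *)

(** Induction on the order: when some nontrivial quotient by [H] keeps the image of [A] sum-free,
    passing back multiplies the divisor bound by [#|H|] and the cardinal by at most that. Otherwise
    [d = #|gT|] works. *)
Lemma card_sum_free_group (gT : finGroupType) (A : {set gT}) k l :
  abelian [set: gT] -> 0 < l -> l < k -> 1 \notin A ^+ k * A^-1 ^+ l ->
  exists2 d, d %| #|gT| & #|A| <= divisor_bound #|gT| k l d.
Proof.
move=> abG l0 lk; have [n] := ubnP #|gT|.
elim: n gT A abG => // n IHn gT A abG ltn nZ.
have [->|A0] := eqVneq A set0; first by exists 1%N; rewrite ?dvd1n // cards0.
have gT0 : 0 < #|gT| by apply/card_gt0P; exists 1.
have [/existsP[H /andP[H1 nZH]]|/existsPn aper] :=
    boolP [exists H : {group gT}, (H :!=: 1) && (1 \notin A ^+ k * A^-1 ^+ l * H)].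
  have NH (X : {set gT}) : X \subset 'N(H).
    by apply: subset_trans (subsetT X) (subset_trans abG _); rewrite cents_norm // centS ?subsetT.
  have quoX (X : {set gT}) i : (X ^+ i) / H = (X / H) ^+ i.
    elim: i => [|i IHi]; first by rewrite !expg0 -[1]/(1%G : {set gT}) quotient1.
    by rewrite !expgS quotientMl // IHi.
  pose Q : finGroupType := coset_of H.
  have cQ : (#|Q| * #|H|)%N = #|gT|.
    rewrite -(cardsT Q) -quotientT card_quotient // mulnC.
    by rewrite -cardsT Lagrange ?subsetT.
  have ltQ : #|Q| < #|gT|.
    have Q0 : 0 < #|Q| by apply/card_gt0P; exists 1.
    by rewrite -cQ -[X in X < _]muln1 ltn_pmul2l // cardG_gt1.
  have [|||d dQ leA] := IHn Q (A / H) _ (leq_trans ltQ _).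
  - by rewrite -quotientT quotient_abelian.
  - by rewrite -ltnS.
  - rewrite -quotientV -!quoX -quotientMl //; apply: contra nZH.
    case/morphimP=> z _ zZ /esym ez.
    have zH : z \in H by apply: coset_idr => //; rewrite (subsetP (NH [set: gT])) ?inE.
    by rewrite -(mulgV z) mem_mulg // groupV.
  exists d; first by rewrite -cQ dvdn_mulr.
  have subA : A \subset cover (rcosets H A).
    apply/subsetP=> a aA; apply/bigcupP; exists (H :* a); last exact: rcoset_refl.
    by apply/rcosetsP; exists a.
  apply: leq_trans (subset_leq_card subA) _; apply: leq_trans (leq_card_cover _) _.
  rewrite (eq_bigr (fun _ => #|H|)) => [|_ /rcosetsP[a _ ->]]; last exact: card_rcoset.
  rewrite sum_nat_const -[#|rcosets H A|]/(#|A : H|) -(card_quotient (NH A)).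
  by rewrite /divisor_bound -cQ -divn_mulAC // mulnA leq_mul2r leA orbT.
exists #|gT|; rewrite //  /divisor_bound divnn gT0 muln1.
have [|w hw] := interval_of_aperiodic abG l0 lk A0 nZ.
  by move=> H H1; have := aper H; rewrite H1 negbK.
suff : #|A|.-1 < ceil_div (#|gT| - (delta k l #|gT| - rem_r k l #|gT|)) (k + l).
  by case: #|A|.
by apply/interval_boundP => //; exists w.
Qed.

(** Links the additive structure of ['I_p.+1] to its multiplicative one, in which the upper bound is
    proved; the operations are convertible. *)
Lemma sumset_setX p h (A : {set 'I_p.+1}) : sumset h A = A ^+ h.
Proof.
have -> : A ^+ h = \prod_(i < h) A.
  by elim: h => [|h IHh]; rewrite ?big_ord0 // big_ord_recl -IHh expgS.
apply/setP=> x; apply/imsetP/prodsgP => [[a /ffun_onP aA ->]|[a aA ->]].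
  by exists a => // i _; apply: aA.
exists [ffun i => a i]; first by apply/ffun_onP=> i; rewrite ffunE aA.
by apply: (@eq_bigr 'I_p.+1) => i _; rewrite ffunE.
Qed.

Theorem theorem6 (n k l : nat) (n_gt0 : 0 < n) (l_gt0 : 0 < l) (l_lt_k : l < k) :
  mu (Zmod n) k l = \max_(d <- divisors n) divisor_bound n k l d.
Proof.
case: n n_gt0 => // p _; apply/eqP; rewrite eqn_leq /mu /=; apply/andP; split.
  apply/bigmax_leqP=> A freeA.
  have abG : abelian [set: 'I_p.+1] := Zp_abelian _.
  have nZ : 1 \notin A ^+ k * A^-1 ^+ l.
    rewrite setXV; apply: contraL freeA => /mulsgP[x y xk].
    rewrite inE => yl /esym/eqP; rewrite -eq_invg_mul => /eqP ey.
    rewrite /sum_free !sumset_setX -setI_eq0; apply/set0Pn; exists x.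
    by rewrite inE xk -[x]invgK ey.
  have [d] := card_sum_free_group abG l_gt0 l_lt_k nZ.
  rewrite card_ord => dp leA; apply: leq_trans leA _.
  by apply: leq_bigmax_seq; rewrite -?dvdn_divisors.
apply/bigmax_leqP_seq=> d; rewrite -dvdn_divisors // => dp _; rewrite /divisor_bound.
have d0 : 0 < d by apply: dvdn_gt0 dp.
case eB : (ceil_div _ _) => [|m]; first by rewrite mul0n.
have [|A freeA <-] := @exists_sum_free p d k l m dp l_lt_k.
  by apply/interval_boundP; rewrite // eB.
exact: (bigmax_sup A).
Qed.
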